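(* Let $\tau\in[0,\frac{\pi}{2}]$, let $\Omega,\tilde\Omega\subset\mathbb{R}^n$ be uniformly convex bounded domains with smooth boundary, $\kappa\in\mathbb{R}^n$ a constant vector and $c\in\mathbb{R}$. Let $u$ be a smooth function on $\Omega$ such that $F_\tau(\lambda(D^2u(x)))$ is defined for all $x\in\Omega$ and $$F_\tau(\lambda(D^2 u))=\kappa\cdot x+c\ \text{ in }\Omega,\qquad Du(\Omega)=\tilde\Omega.$$ Then $\kappa$ is the constant mean curvature of the gradient graph $\{(x,Du(x)):x\in\Omega\}$ in $(\mathbb{R}^n\times\mathbb{R}^n,g_\tau)$, that is, the mean curvature vector of the graph is $\vec H=\kappa^{\perp}$, where $\kappa$ is regarded as the vector $(0,\kappa)=\sum_{l=1}^n\kappa_l e_{n+l}$ of $\mathbb{R}^n\times\mathbb{R}^n$.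
   Context: $\lambda(D^2u)=(\lambda_1,\dots,\lambda_n)$ are the eigenvalues of the Hessian $D^2u$. With $a=\cot\tau$ and $b=\sqrt{|\cot^2\tau-1|}$ (for $\tau>0$), $$F_{\tau}(\lambda)=\begin{cases}\frac12\sum_{i=1}^n\ln\lambda_i,&\tau=0,\\ \frac{\sqrt{a^2+1}}{2b}\sum_{i=1}^n\ln\frac{\lambda_i+a-b}{\lambda_i+a+b},&0<\tau<\frac{\pi}{4},\\ -\sqrt2\sum_{i=1}^n\frac{1}{1+\lambda_i},&\tau=\frac{\pi}{4},\\ \frac{\sqrt{a^2+1}}{b}\sum_{i=1}^n\arctan\frac{\lambda_i+a-b}{\lambda_i+a+b},&\frac{\pi}{4}<\tau<\frac{\pi}{2},\\ \sum_{i=1}^n\arctan\lambda_i,&\tau=\frac{\pi}{2}.\end{cases}$$ ''$F_\tau(\lambda)$ is defined'' means that every term of the sum makes sense (denominators nonzero, arguments of logarithms positive). The metric is $g_\tau=\sin\tau\,\delta_0+\cos\tau\,g_0$ on $\mathbb{R}^n\times\mathbb{R}^n$ with coordinates $(x,y)$, where $\delta_0=\sum_i dx_i\otimes dx_i+\sum_j dy_j\otimes dy_j$ and $g_0=\sum_i dx_i\otimes dy_i+\sum_j dy_j\otimes dx_j$ (a constant-coefficient symmetric form, degenerate when $\tau=\pi/4$). Let $e_1,\dots,e_{2n}$ be the standard basis, and $\overline\nabla$ the standard flat connection of $\mathbb{R}^{2n}$. The tangent vectors of the graph are $E_i=e_i+\sum_j u_{ij}e_{n+j}$, $i=1,\dots,n$.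 The induced metric is $g_{ij}=g_\tau(E_i,E_j)=\sin\tau(\delta_{ij}+\sum_k u_{ik}u_{kj})+2\cos\tau\,u_{ij}$, with inverse $(g^{ij})$. For a vector $V$, $V^\perp$ denotes the component of $V$ in the $g_\tau$-orthogonal complement of $\mathrm{span}(E_1,\dots,E_n)$ (projection along the tangent space; well defined since $(g_{ij})$ is nondegenerate). The mean curvature vector is $\vec H=\sum_{i,j}g^{ij}(\overline\nabla_{E_i}E_j)^\perp$. *)

(* Defs.v *)
From HB Require Import structures.
From mathcomp Require Import all_boot all_order all_algebra.
From mathcomp Require Import all_classical all_reals all_analysis.

Set Implicit Arguments.
Unset Strict Implicit.
Unset Printing Implicit Defensive.
Import Order.TTheory GRing.Theory Num.Theory.
Import numFieldNormedType.Exports.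
Local Open Scope classical_set_scope.
Local Open Scope ring_scope.

Section Calculus.
Context {R : realType} {n : nat}.
Implicit Types (f : 'rV[R]_n -> R) (U : set 'rV[R]_n) (x v : 'rV[R]_n).

Definition dot m (v w : 'rV[R]_m) : R := \sum_(i < m) v 0 i * w 0 i.

Definition partial (i : 'I_n) f : 'rV[R]_n -> R :=
  fun x => 'D_(delta_mx 0 i) f x.

Definition iter_partial (s : seq 'I_n) f : 'rV[R]_n -> R :=
  foldr partial f s.

(* C^oo on an open set: partial derivatives of all orders exist and are
   continuous there. *)
Definition smooth_on U f : Prop :=
  forall (s : seq 'I_n) x, U x ->
    {for x, continuous (iter_partial s f)} /\
    forall i : 'I_n, derivable (iter_partial s f) x (delta_mx 0 i).

Definition grad f x : 'rV[R]_n := \row_i partial i f x.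

Definition hessian f x : 'M[R]_n := \matrix_(i, j) partial i (partial j f) x.

End Calculus.

Section Domains.
Context {R : realType} {n : nat}.
Implicit Types (Om U : set 'rV[R]_n) (rho : 'rV[R]_n -> R) (p : 'rV[R]_n).

Definition boundary Om : set 'rV[R]_n := closure Om `\` interior Om.

Definition domain Om : Prop := [/\ Om !=set0, open Om & connected Om].

Definition local_defining_function Om p U rho : Prop :=
  [/\ open U, U p, smooth_on U rho,
      (forall x, U x -> grad rho x != 0) &
      Om `&` U = [set x | U x /\ rho x < 0]].

Definition smooth_boundary Om : Prop :=
  forall p, boundary Om p ->
    exists U rho, local_defining_function Om p U rho.

(* k is an eigenvalue of the shape operator, with respect to the inner unit
   normal, of the hypersurface {rho = 0} at p: its second fundamental form is
   the restriction of D^2 rho / |D rho| to the tangent space (D rho)^perp, and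
   mu accounts for the normal component of D^2 rho applied to v. *)
Definition principal_curvature rho p (k : R) : Prop :=
  exists2 v : 'rV[R]_n, v != 0 /\ dot (grad rho p) v = 0 &
  exists mu : R,
    v *m hessian rho p =
    (k * Num.sqrt (dot (grad rho p) (grad rho p))) *: v + mu *: grad rho p.

Definition uniformly_convex Om : Prop :=
  convex_set Om /\
  exists2 theta : R, 0 < theta &
    forall p U rho k, boundary Om p -> local_defining_function Om p U rho ->
      principal_curvature rho p k -> theta <= k.

Definition uniformly_convex_bounded_smooth_domain Om : Prop :=
  [/\ domain Om, bounded_set Om, smooth_boundary Om & uniformly_convex Om].

End Domains.

Section Operator.
Context {R : realType} {n : nat}.
Implicit Types (A : 'M[R]_n) (tau : R) (l : 'rV[R]_n).

(* The eigenvalues of A listed with multiplicity, in an unspecified order;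
   they exist when A is symmetric. *)
Definition eigenvalues A : 'rV[R]_n :=
  xget 0 [set l : 'rV[R]_n | char_poly A = \prod_(i < n) ('X - (l 0 i)%:P)].

Definition cot tau : R := cos tau / sin tau.

Definition bcoef tau : R := Num.sqrt `|cot tau ^+ 2 - 1|.

Definition Ftau tau l : R :=
  let a := cot tau in
  let b := bcoef tau in
  if tau == 0 then
    1 / 2 * \sum_i ln (l 0 i)
  else if tau < pi / 4 then
    Num.sqrt (a ^+ 2 + 1) / (2 * b)
      * \sum_i ln ((l 0 i + a - b) / (l 0 i + a + b))
  else if tau == pi / 4 then
    - Num.sqrt 2 * \sum_i (1 / (1 + l 0 i))
  else if tau < pi / 2 then
    Num.sqrt (a ^+ 2 + 1) / b
      * \sum_i atan ((l 0 i + a - b) / (l 0 i + a + b))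
  else \sum_i atan (l 0 i).

Definition Ftau_defined tau l : Prop :=
  let a := cot tau in
  let b := bcoef tau in
  if tau == 0 then forall i, 0 < l 0 i
  else if tau < pi / 4 then
    forall i, l 0 i + a + b != 0 /\
              0 < (l 0 i + a - b) / (l 0 i + a + b)
  else if tau == pi / 4 then forall i, 1 + l 0 i != 0
  else if tau < pi / 2 then forall i, l 0 i + a + b != 0
  else True.

End Operator.

(* Vectors of R^n x R^n are rows of length n + n, so that e_{n+j} is the j-th
   basis vector of the second block. *)
Section GradientGraph.
Context {R : realType} {n : nat}.
Implicit Types (tau : R) (u : 'rV[R]_n -> R) (x : 'rV[R]_n).

Definition delta0 : 'M[R]_(n + n) := 1%:M.
Definition g0 : 'M[R]_(n + n) := block_mx 0 1%:M 1%:M 0.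

Definition gmetric tau : 'M[R]_(n + n) := sin tau *: delta0 + cos tau *: g0.

(* Row i is the tangent vector E_i of the graph at (x, Du(x)). *)
Definition tangent u x : 'M[R]_(n, n + n) := row_mx 1%:M (hessian u x).

Definition induced_metric tau u x : 'M[R]_n :=
  tangent u x *m gmetric tau *m (tangent u x)^T.

(* The row space is the gmetric-orthogonal complement of the tangent space. *)
Definition normal_space tau u x : 'M[R]_(n + n) :=
  kermx (gmetric tau *m (tangent u x)^T).

Definition normal_part tau u x (V : 'rV[R]_(n + n)) : 'rV[R]_(n + n) :=
  V *m proj_mx (normal_space tau u x) <<tangent u x>>%MS.

(* E_j is a vector field along the immersion x |-> (x, Du(x)), which maps the
   i-th coordinate direction to E_i; the flat connection differentiates the
   R^(2n)-valued map E_j in that direction. *)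
Definition flat_deriv u x (i j : 'I_n) : 'rV[R]_(n + n) :=
  'D_(delta_mx 0 i) (fun y => row j (tangent u y)) x.

Definition mean_curvature_vector tau u x : 'rV[R]_(n + n) :=
  \sum_i \sum_j invmx (induced_metric tau u x) i j
                  *: normal_part tau u x (flat_deriv u x i j).

End GradientGraph.

(* Main.v *)
Require Import Defs.
From mathcomp Require Import all_boot all_order all_algebra.
From mathcomp Require Import all_classical all_reals all_analysis.
From mathcomp Require Import complex ring lra.
Import Order.TTheory GRing.Theory Num.Theory.
Import numFieldNormedType.Exports.
Local Open Scope classical_set_scope.
Local Open Scope ring_scope.

(* No eigenvalue is ever differentiated.  Put A = D^2 u and S = kappa . x + c, and
   let p, q be the (possibly complex) roots of p + q = 2 cot tau, p q = 1, so that
   the induced metric is g = sin tau (A + p)(A + q) for tau > 0 and g = 2 A for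
   tau = 0.  The equation F_tau = S implies an identity between functions that are
   polynomial in the entries of A: det A = e^(2 S) for tau = 0;
   det (A + p) / det (A + q) is a constant times the exponential of a real or
   imaginary multiple of S for tau <> pi/4 (the arctangents become arguments of
   complex numbers, so no branch has to be chosen); tr ((A + 1)^-1) is a multiple
   of S for tau = pi/4.  Differentiating it in the direction x_k with Jacobi's
   formula gives kappa_k = tr (g^-1 d_k A) in all cases.  Since the third
   derivatives of u are symmetric, sum_ij g^ij (0, u_ij1, ..., u_ijn) = (0, kappa),
   and the normal projection of this identity is the claim. *)

Set Implicit Arguments.
Unset Strict Implicit.

(** The resolvent identity: [Q - P] is the scalar [q - p], and placing it between the two inverses
    gives their difference. It merges the logarithmic derivatives of two determinants into one trace
    against the inverse of a quadratic in [M]. *)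
Lemma invmx_shiftB (F : fieldType) n (M : 'M[F]_n) (p q : F) :
  M + p%:M \in unitmx -> M + q%:M \in unitmx ->
  invmx (M + p%:M) - invmx (M + q%:M) =
  (q - p) *: invmx ((M + q%:M) *m (M + p%:M)).
Proof.
set P := M + _; set Q := M + _ => Up Uq.
have UQP : Q *m P \in unitmx by rewrite unitmx_mul Uq.
have -> : invmx (Q *m P) = invmx P *m invmx Q.
  apply: (can_inj (mulKmx UQP)).
  by rewrite mulmxV // -mulmxA mulKVmx // mulmxV.
have QB : Q - P = (q - p)%:M by rewrite opprD addrACA subrr add0r raddfB.
rewrite scalemxAl -mul_mx_scalar -QB mulmxBr mulVmx // mulmxBl mul1mx.
by rewrite -mulmxA mulmxV // mulmx1.
Qed.

(** * Complex-valued functions of a real variable *)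

Section ComplexDerivative.
Context {R : realType}.
Implicit Types (f g : R -> R[i]) (t : R) (d : R[i]).

Definition cderiv f t d :=
  is_derive t 1 (fun s => complex.Re (f s)) (complex.Re d) /\
  is_derive t 1 (fun s => complex.Im (f s)) (complex.Im d).

Lemma cderiv_eq f t d d' : cderiv f t d -> d = d' -> cderiv f t d'.
Proof. by move=> H <-. Qed.

Lemma cderiv_unique f t d d' : cderiv f t d -> cderiv f t d' -> d = d'.
Proof.
move=> [[_ r] [_ i]] [[_ r'] [_ i']].
by apply/eqP; rewrite eq_complex -r -r' -i -i' !eqxx.
Qed.

Lemma cderiv_near f g t d :
  (\forall s \near t, f s = g s) -> cderiv f t d -> cderiv g t d.
Proof.
move=> fg [fr fi]; split.
  apply: near_eq_is_derive fr.
  by near=> s; congr (complex.Re _); near: s.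
apply: near_eq_is_derive fi.
by near=> s; congr (complex.Im _); near: s.
Unshelve. all: by end_near. Qed.

Lemma cderiv_cst c t : cderiv (fun _ => c) t 0.
Proof. by split; exact: is_derive_cst. Qed.

Lemma cderiv_real (f : R -> R) t (d : R) :
  is_derive t 1 f d -> cderiv (fun s => (f s)%:C%C) t (d%:C)%C.
Proof. by move=> fd; split=> //=; exact: is_derive_cst. Qed.

Lemma cderivD f g t df dg :
  cderiv f t df -> cderiv g t dg -> cderiv (fun s => f s + g s) t (df + dg).
Proof.
move=> [fr fi] [gr gi]; split.
  rewrite (_ : (fun s => _) = (fun s => complex.Re (f s)) + (fun s => complex.Re (g s))).
    by apply: is_derive_eq; rewrite raddfD.
  by apply/funext => s /=; rewrite raddfD.
rewrite (_ : (fun s => _) = (fun s => complex.Im (f s)) + (fun s => complex.Im (g s))).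
  by apply: is_derive_eq; rewrite raddfD.
by apply/funext => s /=; rewrite raddfD.
Qed.

Lemma cderivM f g t df dg :
  cderiv f t df -> cderiv g t dg ->
  cderiv (fun s => f s * g s) t (df * g t + f t * dg).
Proof.
have ReM (x y : R[i]) : complex.Re (x * y) =
    complex.Re x * complex.Re y - complex.Im x * complex.Im y.
  by case: x y => ? ? [? ?].
have ImM (x y : R[i]) : complex.Im (x * y) =
    complex.Re x * complex.Im y + complex.Im x * complex.Re y.
  by case: x y => ? ? [? ?].
have ReD (x y : R[i]) : complex.Re (x + y) = complex.Re x + complex.Re y.
  by case: x y => ? ? [? ?].
have ImD (x y : R[i]) : complex.Im (x + y) = complex.Im x + complex.Im y.
  by case: x y => ? ? [? ?].
move=> [fr fi] [gr gi]; split.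
  rewrite (_ : (fun s => _) = (fun s => complex.Re (f s)) * (fun s => complex.Re (g s))
                            - (fun s => complex.Im (f s)) * (fun s => complex.Im (g s))).
    by apply: is_derive_eq; rewrite ReD !ReM /GRing.scale /=; ring.
  by apply/funext => s /=; rewrite ReM.
rewrite (_ : (fun s => _) = (fun s => complex.Re (f s)) * (fun s => complex.Im (g s))
                          + (fun s => complex.Im (f s)) * (fun s => complex.Re (g s))).
  by apply: is_derive_eq; rewrite ImD !ImM /GRing.scale /=; ring.
by apply/funext => s /=; rewrite ImM.
Qed.

Lemma cderivZ c f t d : cderiv f t d -> cderiv (fun s => c * f s) t (c * d).
Proof.
move=> fd; apply: cderiv_eq (cderivM (cderiv_cst c t) fd) _.
by rewrite mul0r add0r.
Qed.

Lemma cderiv_sum (I : Type) (r : seq I) (P : pred I) (F : I -> R -> R[i]) dF t :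
  (forall i, P i -> cderiv (F i) t (dF i)) ->
  cderiv (fun s => \sum_(i <- r | P i) F i s) t (\sum_(i <- r | P i) dF i).
Proof.
move=> H; elim: r => [|i r IH].
  by rewrite big_nil; under eq_fun do rewrite big_nil; exact: cderiv_cst.
rewrite big_cons; under eq_fun do rewrite big_cons.
by case: ifP => // Pi; apply: cderivD => //; exact: H.
Qed.

(** The differentiated factor is marked by a test on the index, so that in the Leibniz expansion of
    a determinant the [k]-th summand reads as the term of a matrix with row [k] replaced. *)
Lemma cderiv_prod (n : nat) (F : 'I_n -> R -> R[i]) dF t :
  (forall i, cderiv (F i) t (dF i)) ->
  cderiv (fun s => \prod_i F i s) t
    (\sum_k \prod_i (if i == k then dF i else F i t)).
Proof.
elim: n => [|n IH] in F dF *.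
  move=> _; rewrite big_ord0; under eq_fun do rewrite big_ord0.
  exact: cderiv_cst.
move=> H; rewrite big_ord_recl; under eq_fun do rewrite big_ord_recl.
apply: cderiv_eq.
  apply: cderivM; first exact: H.
  by apply: IH => i; exact: H.
congr (_ + _).
  by rewrite big_ord_recl eqxx.
rewrite big_distrr; apply: eq_bigr => k _.
by rewrite big_ord_recl.
Qed.

(** * Matrix-valued functions and Jacobi's formula *)

Definition mderiv {m n} (M : R -> 'M[R[i]]_(m, n)) t (M' : 'M[R[i]]_(m, n)) :=
  forall i j, cderiv (fun s => M s i j) t (M' i j).

Lemma mderivM {m n p} (M : R -> 'M[R[i]]_(m, n)) (N : R -> 'M[R[i]]_(n, p))
    t M' N' : mderiv M t M' -> mderiv N t N' ->
  mderiv (fun s => M s *m N s) t (M' *m N t + M t *m N').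
Proof.
move=> HM HN i j; under eq_fun do rewrite mxE.
apply: cderiv_eq; first by apply: cderiv_sum => k _; apply: cderivM.
by rewrite !mxE -big_split.
Qed.

Lemma mderiv_addcst {m n} (M : R -> 'M[R[i]]_(m, n)) t M' N :
  mderiv M t M' -> mderiv (fun s => M s + N) t M'.
Proof.
move=> HM i j; under eq_fun do rewrite mxE.
by apply: cderiv_eq (cderivD (HM i j) (cderiv_cst _ _)) _; rewrite addr0.
Qed.

Lemma cderiv_tr {n} (M : R -> 'M[R[i]]_n) t M' :
  mderiv M t M' -> cderiv (fun s => \tr (M s)) t (\tr M').
Proof. by move=> HM; apply: cderiv_sum => i _; exact: HM. Qed.

(** Jacobi's formula. The product rule, applied to the Leibniz expansion, gives a sum over [k] of
    determinants in which row [k] is differentiated; expanding each along that row produces the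
    cofactors of [M t]. *)
Lemma cderiv_det {n} (M : R -> 'M[R[i]]_n) t M' :
  mderiv M t M' -> cderiv (fun s => \det (M s)) t (\tr (M' *m \adj (M t))).
Proof.
move=> HM; apply: cderiv_eq.
  apply: cderiv_sum => s _; apply: cderivZ; apply: cderiv_prod => i.
  exact: HM.
under eq_bigr do rewrite big_distrr.
rewrite exchange_big; apply: eq_bigr => k _ /=.
pose N := \matrix_(i, j) (if i == k then M' i j else M t i j).
transitivity (\det N).
  apply: eq_bigr => s _; congr (_ * _); apply: eq_bigr => i _.
  by rewrite mxE.
rewrite (expand_det_row N k) mxE; apply: eq_bigr => j _.
rewrite !mxE eqxx; congr (_ * _).
(* The cofactors along row [k] do not see row [k], the only one where [N] differs from [M t]. *)
rewrite /cofactor; congr (_ * \det _); apply/matrixP => a b.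
by rewrite !mxE eq_sym (negPf (neq_lift _ _)).
Qed.

(** Differentiability alone is recorded; a usable value of the derivative is recovered later from
    the relation between a matrix and its adjugate. *)
Lemma mderiv_adj {n} (M : R -> 'M[R[i]]_n) t M' :
  mderiv M t M' -> exists N', mderiv (fun s => \adj (M s)) t N'.
Proof.
move=> HM.
exists (\matrix_(i, j) ((-1) ^+ (j + i) *
   \tr (row' j (col' i M') *m \adj (row' j (col' i (M t)))))) => i j.
rewrite mxE; under eq_fun do rewrite mxE.
apply: cderivZ; apply: cderiv_det => a b.
by rewrite !mxE; under eq_fun do rewrite !mxE; exact: HM.
Qed.

Lemma cderiv_logdet {n} (M : R -> 'M[R[i]]_n) t M' :
  mderiv M t M' -> M t \in unitmx ->
  cderiv (fun s => \det (M s)) t (\tr (invmx (M t) *m M') * \det (M t)).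
Proof.
move=> HM U; apply: cderiv_eq (cderiv_det HM) _.
by rewrite mxtrace_mulC /invmx U -scalemxAl linearZ /= mulrC mulrA divff ?mul1r.
Qed.

(** Jacobi's formula differentiates both sides; the equation at [t] then eliminates [C], and
    dividing by the nonzero [E t * \det (M t + q%:M)] leaves [e] as a difference of two traces, to
    which the resolvent identity applies. *)
Lemma logderiv_ratio {n} (M : R -> 'M[R[i]]_n) t M' (p q C : R[i])
    (E : R -> R[i]) (e : R[i]) :
  mderiv M t M' -> cderiv E t (e * E t) ->
  (\forall s \near t, E s * \det (M s + q%:M) = C * \det (M s + p%:M)) ->
  E t != 0 -> M t + p%:M \in unitmx -> M t + q%:M \in unitmx ->
  e = (q - p) * \tr (invmx ((M t + q%:M) *m (M t + p%:M)) *m M').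
Proof.
move=> HM HE near_eq E0 Up Uq.
have Hp := cderiv_logdet (mderiv_addcst (p%:M) HM) Up.
have Hq := cderiv_logdet (mderiv_addcst (q%:M) HM) Uq.
have eq_t := nbhs_singleton near_eq.
have := cderiv_unique (cderiv_near near_eq (cderivM HE Hq)) (cderivZ C Hp).
set tq := \tr (_ *m _); set tp := \tr (_ *m _); set dq := \det _ => H.
have dq0 : E t * dq != 0.
  by rewrite mulf_neq0 // -unitfE; move: Uq; rewrite unitmxE.
have {H} -> : e = tp - tq.
  apply/eqP; rewrite -subr_eq0; apply/eqP/(mulIf dq0); rewrite mul0r.
  transitivity (e * E t * dq + E t * (tq * dq) - tp * (E t * dq)); first by ring.
  by rewrite H [E t * dq]eq_t; ring.
by rewrite -linearB -mulmxBl /= -mxtraceZ scalemxAl invmx_shiftB.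
Qed.

(** The double-root counterpart of [logderiv_ratio]: the hypothesis says that [S] is the trace of
    the inverse of [M + p], written without division so that both sides stay polynomial in the
    entries of [M]. *)
Lemma logderiv_resolvent {n} (M : R -> 'M[R[i]]_n) t M' (p : R[i])
    (S : R -> R[i]) (s : R[i]) :
  mderiv M t M' -> cderiv S t s ->
  (\forall h \near t, S h * \det (M h + p%:M) = \tr (\adj (M h + p%:M))) ->
  M t + p%:M \in unitmx ->
  s = - \tr (invmx ((M t + p%:M) *m (M t + p%:M)) *m M').
Proof.
move=> HM HS near_eq Up.
have HN := mderiv_addcst (p%:M) HM.
have [N' HN'] := mderiv_adj HN.
have Hd := cderiv_logdet HN Up.
have eq_t := nbhs_singleton near_eq.
have := cderiv_unique (cderiv_near near_eq (cderivM HS Hd)) (cderiv_tr HN').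
move: eq_t Hd HN' HN Up {near_eq}; set P := M t + _ => eq_t Hd HN' HN Up H.
have d0 : \det P != 0 by rewrite -unitfE -unitmxE.
have adjE : \adj P = \det P *: invmx P.
  by rewrite /invmx Up scalerA divff // scale1r.
(* Both sides are the derivative of [\adj P *m P], which is the scalar matrix of [\det P]; solving
   for [N'] gives the derivative of the adjugate. *)
have : N' *m P + \adj P *m M' = (\tr (invmx P *m M') * \det P)%:M.
  apply/matrixP => i j.
  apply: (@cderiv_unique (fun h => (\adj (M h + p%:M) *m (M h + p%:M)) i j) t).
    exact: (mderivM HN' HN).
  under eq_fun do rewrite mul_adj_mx mxE.
  rewrite mxE; case: (i == j); rewrite ?mulr1n ?mulr0n; first exact: Hd.
  exact: cderiv_cst.
set tq := \tr (_ *m M') in H * => HP.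
have N'E : N' = (tq * \det P) *: invmx P - \det P *: (invmx P *m M' *m invmx P).
  rewrite -[LHS](mulmxK Up) -[N' *m P](addrK (\adj P *m M')) HP mulmxBl.
  by rewrite mul_scalar_mx adjE -!scalemxAl.
have trE : \tr (invmx P *m M' *m invmx P) = \tr (invmx (P *m P) *m M').
  rewrite mxtrace_mulC mulmxA; congr (\tr (_ *m _)).
  have UPP : P *m P \in unitmx by rewrite unitmx_mul Up.
  apply: (can_inj (mulKmx UPP)).
  by rewrite mulmxV // -mulmxA mulKVmx // mulmxV.
apply: (mulIf d0).
(* After this addition the left side is the derivative of [S * \det P], hence equals [\tr N']. *)
apply: (addIr (S t * (tq * \det P))); rewrite H N'E raddfB /= !mxtraceZ trE.
rewrite [RHS]addrC mulrCA eq_t adjE mxtraceZ; ring.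
Qed.

(** * Real and imaginary exponentials *)

Lemma cderiv_expR (f : R -> R) (t d : R) : is_derive t 1 f d ->
  cderiv (fun s => (expR (f s))%:C%C) t (d%:C%C * (expR (f t))%:C%C).
Proof.
move=> fd; rewrite -rmorphM; apply: cderiv_real.
by rewrite mulrC; apply: (is_derive1_comp (f := expR)).
Qed.

Definition cis (x : R) : R[i] := (cos x +i* sin x)%C.

Lemma cisD x y : cis (x + y) = cis x * cis y.
Proof.
by apply/eqP; rewrite eq_complex /= cosD sinD eqxx [sin x * _ + _]addrC eqxx.
Qed.

Lemma cis_sum n (f : 'I_n -> R) : cis (\sum_i f i) = \prod_i cis (f i).
Proof.
elim: n f => [|n IH] f; first by rewrite !big_ord0 /cis cos0 sin0.
by rewrite !big_ord_recl cisD IH.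
Qed.

Lemma cis_neq0 x : cis x != 0.
Proof.
rewrite eq_complex /=; apply/negP => /andP[/eqP c /eqP s].
have := cos2Dsin2 x; rewrite c s expr0n addr0 => /eqP.
by rewrite eq_sym oner_eq0.
Qed.

Lemma cderiv_cis (f : R -> R) (t d : R) : is_derive t 1 f d ->
  cderiv (fun s => cis (f s)) t ((d *i)%C * cis (f t)).
Proof.
move=> fd; rewrite /cis; split => /=.
  by apply: is_derive_eq; ring.
by apply: is_derive_eq; ring.
Qed.

(* x + i y = x (1 + i tan al) = (x / cos al) cis al is a real multiple of cis al,
   with al = atan (y / x) and whatever the sign of x. *)
Lemma cis_2atan (x y : R) : x != 0 ->
  (x +i* y)%C = cis (2 * atan (y / x)) * (x -i* y)%C.
Proof.
move=> x0; set al := atan _.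
have c0 : 0 < cos al by apply: cos_gt0_pihalf; rewrite atan_gtNpi2 atan_ltpi2.
have yE : y = x * sin al / cos al.
  have : tan al = y / x by rewrite /al atanK.
  rewrite /tan => /(congr1 (fun z => z * x)); rewrite divfK // => <-; ring.
have cs := cos2Dsin2 al.
have cn0 : cos al != 0 by rewrite gt_eqF.
have s2 : sin al ^+ 2 = 1 - cos al ^+ 2 by rewrite -cs; ring.
apply/eqP; rewrite eq_complex /= mulr_natl cos_mulr2n sin_mulr2n yE.
by apply/andP; split; apply/eqP; field: s2 => //; rewrite -?mulr2n.
Qed.

End ComplexDerivative.

(** * Eigenvalues of real symmetric matrices *)

Lemma horner_char_poly (F : comNzRingType) n (M : 'M[F]_n) (z : F) :
  (char_poly M).[z] = \det (z%:M - M).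
Proof.
rewrite -[LHS]/(horner_eval z (char_poly M)) -det_map_mx; congr (\det _).
apply/matrixP => i j.
by rewrite !mxE raddfB raddfMn /= /horner_eval hornerX hornerC.
Qed.

Section Spectrum.
Context {R : realType}.
Notation RC := (real_complex R).

(** The complexification is Hermitian, so the spectral theorem diagonalises it with real diagonal;
    the factorisation descends to [R] because extending the coefficients of polynomials to [R[i]] is
    injective. *)
Lemma char_poly_symmetric {n} (A : 'M[R]_n) : A^T = A ->
  exists l : 'rV[R]_n, char_poly A = \prod_(i < n) ('X - (l 0 i)%:P).
Proof.
move=> AT; pose B := map_mx RC A.
have Bherm : B \is hermsymmx.
  apply: realsym_hermsym.
    apply/is_hermitianmxP; rewrite expr0 scale1r; apply/matrixP => i j.
    by rewrite !mxE -{1}AT mxE.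
  by apply/mxOverP => i j; rewrite mxE; apply/complex_realP; exists (A i j).
have /orthomx_spectralP BE := hermitian_normalmx Bherm.
have /mxOverP dreal := hermitian_spectral_diag_real Bherm.
move: BE (spectral_unit B) dreal.
move: (spectralmx B) (spectral_diag B) => P d BE UP dreal.
exists (\row_i complex.Re (d 0 i)).
apply: (map_poly_inj RC); rewrite map_char_poly -/B rmorph_prod /=.
transitivity (char_poly (diag_mx d)); last first.
  rewrite char_poly_trig ?diag_mx_is_trig //; apply: eq_bigr => i _.
  by rewrite !mxE eqxx mulr1n rmorphB /= map_polyX map_polyC /= RRe_real.
rewrite BE /char_poly; pose Q := map_mx polyC P.
(* The scalar matrix ['X] is conjugated by [P] as well, so that the whole characteristic matrix is a
   conjugate of that of [diag_mx d]. *)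
have polyC_scalar : 'X%:M = map_mx polyC (invmx P) *m 'X%:M *m Q.
  by rewrite scalar_mxC -mulmxA -map_mxM mulVmx // map_mx1 mulmx1.
rewrite /char_poly_mx !map_mxM {1}polyC_scalar -mulmxBl -mulmxBr !det_mulmx.
by rewrite mulrAC -det_mulmx -map_mxM mulVmx // map_mx1 det1 mul1r.
Qed.

(** Symmetry makes the set inside [xget] nonempty, which rules out the default value 0. *)
Lemma eigenvaluesP {n} (A : 'M[R]_n) : A^T = A ->
  char_poly A = \prod_(i < n) ('X - (eigenvalues A 0 i)%:P).
Proof.
move=> /char_poly_symmetric[l Hl]; rewrite /eigenvalues.
by case: xgetP => [_ _ //|/(_ l)].
Qed.

Lemma det_shift {n} (A : 'M[R]_n) (l : 'rV[R]_n) (z : R[i]) :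
  char_poly A = \prod_(i < n) ('X - (l 0 i)%:P) ->
  \det (map_mx RC A + z%:M) = \prod_i (RC (l 0 i) + z).
Proof.
move=> Al; have -> : map_mx RC A + z%:M = - ((- z)%:M - map_mx RC A).
  by rewrite opprB raddfN /= opprK.
rewrite -scaleN1r detZ -horner_char_poly -map_char_poly Al rmorph_prod horner_prod.
(* The sign [(-1) ^+ n] is distributed over the [n] linear factors. *)
rewrite -[in X in X * _](card_ord n) -prodr_const -big_split; apply: eq_bigr => i _.
by rewrite /= rmorphB /= map_polyX map_polyC /= !hornerE; ring.
Qed.

(* Both sides are the derivative of s |-> det (A + s) at s = 1. *)
Lemma trace_adj_shift {n} (A : 'M[R]_n) (l : 'rV[R]_n) :
  char_poly A = \prod_(i < n) ('X - (l 0 i)%:P) ->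
  (forall i, 1 + l 0 i != 0) ->
  \tr (\adj (map_mx RC A + 1%:M)) =
  RC (\sum_i (1 / (1 + l 0 i))) * \det (map_mx RC A + 1%:M).
Proof.
move=> Al l0; set B := map_mx RC A.
have idC : cderiv (fun s => RC s) 1 1.
  by have := cderiv_real (is_derive_id (1 : R) 1); rewrite rmorph1.
have Hdet : cderiv (fun s => \det (B + (RC s)%:M)) 1
    (\tr (1%:M *m \adj (B + (RC 1)%:M))).
  apply: cderiv_det => i j; under eq_fun do rewrite mxE [_%:M _ _]mxE.
  have E : 1%:M i j = 0 + (i == j)%:R * (1 : R[i]) by rewrite mxE add0r mulr1.
  rewrite E; apply: cderivD; first exact: cderiv_cst.
  under eq_fun do rewrite -mulr_natl; exact: cderivZ.
have Hprod : cderiv (fun s => \prod_i (RC (l 0 i) + RC s)) 1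
    (\sum_k \prod_i (if i == k then 0 + 1 else RC (l 0 i) + RC 1)).
  by apply: cderiv_prod => i; apply: cderivD => //; exact: cderiv_cst.
have {Hprod}Hdet' : cderiv (fun s => \det (B + (RC s)%:M)) 1
    (\sum_k \prod_i (if i == k then 0 + 1 else RC (l 0 i) + RC 1)).
  by under eq_fun do rewrite (det_shift _ Al).
have := cderiv_unique Hdet Hdet'; rewrite mul1mx rmorph1 => ->.
rewrite (det_shift _ Al) rmorph_sum /= mulr_suml; apply: eq_bigr => k _.
rewrite (bigD1 k) //= eqxx add0r mul1r [in RHS](bigD1 k) //=.
have lk : RC (l 0 k) + 1 != 0.
  by rewrite -(rmorph1 RC) -rmorphD /= fmorph_eq0 addrC.
rewrite mul1r fmorphV rmorphD rmorph1 /= [1 + _]addrC mulKf //.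
by apply: eq_bigr => i /negPf ->.
Qed.

End Spectrum.

Lemma expR_sum_ln {R : realType} n (f : 'I_n -> R) :
  (forall i, 0 < f i) -> expR (\sum_i ln (f i)) = \prod_i f i.
Proof.
move=> f0; elim: n f f0 => [|n IH] f f0; first by rewrite !big_ord0 expR0.
by rewrite !big_ord_recl expRD lnK ?posrE // IH.
Qed.

(** * Trigonometry of the angle [tau] *)

Section AngleFacts.
Context {R : realType}.
Context (tau : R) (tau0 : 0 < tau) (tau1 : tau <= pi / 2).

Lemma sin_gt0 : 0 < sin tau.
Proof.
have := pi_gt0 R => p0; apply: sin_gt0_pi; rewrite tau0 /=; move: tau1; lra.
Qed.

Lemma cos_cot : cos tau = cot tau * sin tau.
Proof. by rewrite /cot divfK // gt_eqF // sin_gt0. Qed.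

(** This is the numerator of the prefactors of [Ftau]; it supplies the [sin tau] that matches the
    one in the metric. *)
Lemma sqrt_cot : Num.sqrt (cot tau ^+ 2 + 1) = (sin tau)^-1.
Proof.
have s0 := sin_gt0.
have -> : cot tau ^+ 2 + 1 = (sin tau)^-1 ^+ 2.
  have -> : 1 = sin tau ^+ 2 / sin tau ^+ 2 by rewrite divff // expf_neq0 // gt_eqF.
  by rewrite /cot expr_div_n -mulrDl cos2Dsin2 mul1r exprVn.
by rewrite sqrtr_sqr ger0_norm // invr_ge0 ltW.
Qed.

Lemma sin_pihalfB : sin (pi / 2 - tau) = cos tau.
Proof. by rewrite -[LHS]opprK -sinN opprB sinBpihalf opprK. Qed.

(** The sine is increasing on [[- pi / 2, pi / 2]], and the cosine of [tau] is the sine of the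
    complementary angle. *)
Lemma cos_lt_sin : (cos tau < sin tau) = (pi / 4 < tau).
Proof.
have p0 := pi_gt0 R; have h : pi / 2 = 2 * (pi / 4) :> R by field.
rewrite -sin_pihalfB ltr_sin ?in_itv /= ?h; first (by apply/idP/idP; lra);
  by move: tau0 tau1; lra.
Qed.

Lemma sin_lt_cos : (sin tau < cos tau) = (tau < pi / 4).
Proof.
have p0 := pi_gt0 R; have h : pi / 2 = 2 * (pi / 4) :> R by field.
rewrite -sin_pihalfB ltr_sin ?in_itv /= ?h; first (by apply/idP/idP; lra);
  by move: tau0 tau1; lra.
Qed.

Lemma cot_gt1 : tau < pi / 4 -> 1 < cot tau.
Proof. by rewrite /cot -sin_lt_cos ltr_pdivlMr ?sin_gt0 // mul1r. Qed.

Lemma cot_lt1 : pi / 4 < tau -> cot tau < 1.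
Proof. by rewrite /cot -cos_lt_sin ltr_pdivrMr ?sin_gt0 // mul1r. Qed.

Lemma cot_ge0 : 0 <= cot tau.
Proof.
rewrite divr_ge0 ?(ltW sin_gt0) // cos_ge0_pihalf // tau1 andbT.
by have := pi_gt0 R; move: tau0; lra.
Qed.

End AngleFacts.

Lemma exprn_prod_ord (F : comNzRingType) n (c : F) : c ^+ n = \prod_(i < n) c.
Proof. by rewrite prodr_const card_ord. Qed.

(** * The trace identity along a curve of symmetric matrices *)

Section TraceIdentity.
Context {R : realType} {n : nat}.
Notation RC := (real_complex R).
Context (A : R -> 'M[R]_n) (A' : 'M[R]_n) (l : R -> 'rV[R]_n).
Context (S : R -> R) (k : R).
Context (hA : forall i j, is_derive (0 : R) 1 (fun h => A h i j) (A' i j)).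
Context (hl : \forall h \near (0 : R),
  char_poly (A h) = \prod_(i < n) ('X - (l h 0 i)%:P)).
Context (hS : is_derive (0 : R) 1 S k).

Let M h := map_mx RC (A h).
Let M' := map_mx RC A'.

(** The induced metric as a polynomial in the Hessian [B]; symmetry of the Hessian turns [B *m B^T]
    into [B *m B]. *)
Definition graph_metric (tau : R) (B : 'M[R]_n) : 'M[R]_n :=
  sin tau *: (1%:M + B *m B) + (2 * cos tau) *: B.

Lemma mderiv_complexified : mderiv M 0 M'.
Proof.
move=> i j; rewrite mxE; under eq_fun do rewrite mxE.
exact: cderiv_real.
Qed.

Lemma shift_unit (z : R[i]) :
  (forall i, RC (l 0 0 i) + z != 0) -> M 0 + z%:M \in unitmx.
Proof.
move=> l0; rewrite unitmxE unitfE (det_shift _ (nbhs_singleton hl)).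
by apply/prodf_neq0 => i _.
Qed.

(** The common last step for [tau > 0]: with these values of [p + q] and [p * q], the product [Q] is
    the metric divided by [sin tau]. Invertibility and trace are read over [R[i]] and carried back
    to [R]. *)
Lemma graph_metric_trace tau (p q : R[i]) : sin tau != 0 ->
  RC (sin tau) * (p + q) = RC (2 * cos tau) -> p * q = 1 ->
  M 0 + p%:M \in unitmx -> M 0 + q%:M \in unitmx ->
  RC (sin tau * k) = \tr (invmx ((M 0 + q%:M) *m (M 0 + p%:M)) *m M') ->
  graph_metric tau (A 0) \in unitmx /\
  \tr (invmx (graph_metric tau (A 0)) *m A') = k.
Proof.
move=> s0 pDq pMq Up Uq.
set G := graph_metric _ _; set Q := _ *m (_ + p%:M) => trQ.
have GE : map_mx RC G = RC (sin tau) *: Q.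
  rewrite map_mxD !map_mxZ map_mxD map_mxM map_mx1 /= -pDq -/(M 0).
  rewrite -scalerA -scalerDr; congr (_ *: _).
  rewrite /Q mulmxDl !mulmxDr -scalar_mxM [q * p]mulrC pMq.
  rewrite mul_mx_scalar mul_scalar_mx scalerDl.
  by rewrite [1%:M + _]addrC -!addrA; congr (_ + _); rewrite [LHS]addrC -!addrA.
have UQ : Q \in unitmx by rewrite unitmx_mul Uq.
have UG : map_mx RC G \in unitmx by rewrite GE unitmxZ // unitfE fmorph_eq0.
split; first by rewrite -(map_unitmx RC).
apply: (complexI (R := R)); rewrite -trace_map_mx map_mxM map_invmx -/M' GE.
have -> : invmx (RC (sin tau) *: Q) = (RC (sin tau))^-1 *: invmx Q.
  by apply: invmxZ; rewrite -GE.
by rewrite -scalemxAl mxtraceZ -trQ rmorphM /= mulKf // fmorph_eq0.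
Qed.

(** The metric is linear in [A] here, so Jacobi's formula for a single determinant suffices; the
    factor 2 in the metric is the one in [expR (2 * S h)]. *)
Lemma trace_identity_log :
  (\forall h \near (0 : R), forall i, 0 < l h 0 i) ->
  (\forall h \near (0 : R), 1 / 2 * \sum_i ln (l h 0 i) = S h) ->
  graph_metric 0 (A 0) \in unitmx /\
  \tr (invmx (graph_metric 0 (A 0)) *m A') = k.
Proof.
move=> lpos eqS.
have -> : graph_metric 0 (A 0) = 2 *: A 0.
  by rewrite /graph_metric sin0 cos0 scale0r add0r mulr1.
have UM : M 0 \in unitmx.
  rewrite -[M 0]addr0 -(raddf0 (@scalar_mx _ n)); apply: shift_unit => i.
  by rewrite addr0 fmorph_eq0 gt_eqF // (nbhs_singleton lpos).
have UA : A 0 \in unitmx by rewrite -(map_unitmx RC).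
have U2A : 2 *: A 0 \in unitmx by rewrite unitmxZ // unitfE.
split=> //.
have d2S : is_derive (0 : R) 1 (fun h => 2 * S h) (2 * k).
  exact: is_deriveZ.
have near_eq : \forall h \near (0 : R), RC (expR (2 * S h)) = \det (M h).
  near=> h.
  have -> : 2 * S h = \sum_i ln (l h 0 i).
    have <- : 1 / 2 * \sum_i ln (l h 0 i) = S h by near: h.
    by rewrite mulrA mul1r divff // mul1r.
  rewrite expR_sum_ln; last by near: h.
  rewrite -[M h]addr0 -(raddf0 (@scalar_mx _ n)) (det_shift (l := l h)); last by near: h.
  by rewrite rmorph_prod; apply: eq_bigr => i _; rewrite addr0.
have := cderiv_unique (cderiv_near near_eq (cderiv_expR d2S))
  (cderiv_logdet mderiv_complexified UM).
have d0 : \det (M 0) != 0 by rewrite -unitfE -unitmxE.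
rewrite (nbhs_singleton near_eq) => /(mulIf d0) H.
apply: (mulfI (_ : 2 != 0 :> R)) => //; apply: (complexI (R := R)).
rewrite H invmxZ // -scalemxAl mxtraceZ mulrA divff // mul1r.
by rewrite -trace_map_mx map_mxM map_invmx.
Unshelve. all: by end_near. Qed.

(** Here [a > 1], so the roots [a - b] and [a + b] are real, and exponentiating the sum of
    logarithms gives the quotient of the two shifted determinants. *)
Lemma trace_identity_ratio (tau : R) : 0 < tau -> tau < pi / 4 ->
  let a := cot tau in let b := bcoef tau in
  (\forall h \near (0 : R), forall i,
     l h 0 i + a + b != 0 /\ 0 < (l h 0 i + a - b) / (l h 0 i + a + b)) ->
  (\forall h \near (0 : R), Num.sqrt (a ^+ 2 + 1) / (2 * b)
      * \sum_i ln ((l h 0 i + a - b) / (l h 0 i + a + b)) = S h) ->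
  graph_metric tau (A 0) \in unitmx /\
  \tr (invmx (graph_metric tau (A 0)) *m A') = k.
Proof.
move=> t0 t1 a b def eqS.
have t2 : tau <= pi / 2 by have := pi_gt0 R; lra.
have s0 := sin_gt0 t0 t2; have sn0 : sin tau != 0 by rewrite gt_eqF.
have a1 : 1 < a := cot_gt1 t0 t2 t1.
have a2 : 0 < a ^+ 2 - 1 by rewrite subr_gt0 expr_gt1 // ltW // (lt_trans ltr01).
have b0 : 0 < b by rewrite sqrtr_gt0 normr_gt0 gt_eqF.
have bb : b ^+ 2 = a ^+ 2 - 1 by rewrite sqr_sqrtr ?normr_ge0 // gtr0_norm.
have bn0 : b != 0 by rewrite gt_eqF.
rewrite (sqrt_cot t0 t2) in eqS.
have lq h i (z : R) : RC (l h 0 i) + RC (a + z) = RC (l h 0 i + a + z).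
  by rewrite -rmorphD addrA.
have Up : M 0 + (RC (a - b))%:M \in unitmx.
  apply: shift_unit => i; rewrite lq fmorph_eq0.
  (* Positivity of the quotient excludes a zero numerator. *)
  have [] := nbhs_singleton def i => q0; apply: contraTneq => ->.
  by rewrite mul0r ltxx.
have Uq : M 0 + (RC (a + b))%:M \in unitmx.
  apply: shift_unit => i; rewrite lq fmorph_eq0.
  by have [] := nbhs_singleton def i.
apply: (graph_metric_trace (p := RC (a - b)) (q := RC (a + b))) => //.
- by rewrite -rmorphD -rmorphM /= (cos_cot t0 t2); congr RC; rewrite -/a; ring.
- rewrite -rmorphM /= (_ : _ * _ = 1) ?rmorph1 //.
  by rewrite -subr_sqr bb; ring.
(* The constant is the inverse of the prefactor of [Ftau], so [f] is the bare sum of logarithms. *)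
pose f h := (2 * b * sin tau) * S h.
have df : is_derive (0 : R) 1 f (2 * b * sin tau * k).
  exact: is_deriveZ.
have := logderiv_ratio (p := RC (a - b)) (q := RC (a + b)) (C := 1)
  mderiv_complexified (cderiv_expR df) _ _ Up Uq.
rewrite -/M' => H.
have {}H : RC (2 * b * sin tau * k) = (RC (a + b) - RC (a - b)) *
    \tr (invmx ((M 0 + (RC (a + b))%:M) *m (M 0 + (RC (a - b))%:M)) *m M').
  apply: H; last by rewrite fmorph_eq0 gt_eqF // expR_gt0.
  near=> h; rewrite mul1r !(det_shift (l := l h)); do ?by near: h.
  have -> : f h = \sum_i ln ((l h 0 i + a - b) / (l h 0 i + a + b)).
    rewrite /f.
    have <- : (sin tau)^-1 / (2 * b) * \sum_i ln ((l h 0 i + a - b) / (l h 0 i + a + b)) = S h by near: h.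
    by field; rewrite bn0 sn0.
  have hdef : forall i, l h 0 i + a + b != 0 /\ 0 < (l h 0 i + a - b) / (l h 0 i + a + b).
    by near: h.
  rewrite expR_sum_ln => [|i]; last by have [] := hdef i.
  rewrite rmorph_prod -big_split; apply: eq_bigr => i _; rewrite /= !lq -rmorphM /=.
  by rewrite divfK //; have [] := hdef i.
apply: (mulfI (_ : RC (2 * b) != 0)); first by rewrite fmorph_eq0 mulf_neq0.
rewrite -rmorphM /= mulrA H -rmorphB /=; congr (RC _ * _); ring.
Unshelve. all: by end_near. Qed.

(** The roots coincide at 1. As [Num.sqrt 2] is the inverse of [sin (pi / 4)], the trace of the
    resolvent is [- sin (pi / 4) * S h]. *)
Lemma trace_identity_resolvent :
  (\forall h \near (0 : R), forall i, 1 + l h 0 i != 0) ->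
  (\forall h \near (0 : R),
     - Num.sqrt 2 * \sum_i (1 / (1 + l h 0 i)) = S h) ->
  graph_metric (pi / 4) (A 0) \in unitmx /\
  \tr (invmx (graph_metric (pi / 4) (A 0)) *m A') = k.
Proof.
move=> def eqS.
have p0 := pi_gt0 R.
have t0 : 0 < pi / 4 :> R by lra.
have t2 : pi / 4 <= pi / 2 :> R by lra.
have s0 := sin_gt0 t0 t2; have sn0 : sin (pi / 4) != 0 :> R by rewrite gt_eqF.
have cs : cos (pi / 4) = sin (pi / 4) :> R.
  (* At [pi / 4] neither strict comparison of sine and cosine holds. *)
  apply/eqP; rewrite eq_le !leNgt (cos_lt_sin t0 t2) (sin_lt_cos t0 t2).
  by rewrite ltxx.
have s2 : Num.sqrt 2 = (sin (pi / 4))^-1 :> R.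
  rewrite -(sqrt_cot t0 t2) /cot cs divff // expr1n; congr Num.sqrt.
have U1 : M 0 + 1%:M \in unitmx.
  apply: shift_unit => i.
  by rewrite -(rmorph1 RC) -rmorphD fmorph_eq0 addrC; exact: nbhs_singleton def i.
have dS : is_derive (0 : R) 1 (fun h => - sin (pi / 4) * S h) (- sin (pi / 4) * k).
  exact: is_deriveZ.
apply: (graph_metric_trace (p := 1) (q := 1)) => //.
- by rewrite cs -(rmorph1 RC) -rmorphD -rmorphM mulrC.
- by rewrite mulr1.
apply: oppr_inj; rewrite -rmorphN -mulNr /=.
apply: logderiv_resolvent mderiv_complexified (cderiv_real dS) _ U1.
near=> h; rewrite (trace_adj_shift (l := l h)); do ?by near: h.
congr (RC _ * _).
have <- : - Num.sqrt 2 * \sum_i (1 / (1 + l h 0 i)) = S h by near: h.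
by rewrite s2 mulrA mulrNN divff // mul1r.
Unshelve. all: by end_near. Qed.

(** Shared by both arctangent cases: the roots [a -i* b] and [a +i* b] are conjugate of modulus 1,
    and [cis (2 * theta h)] has logarithmic derivative [2 * d] times the imaginary unit. *)
Lemma trace_identity_cis (tau b : R) (theta : R -> R) (d : R) (C : R[i]) :
  let a := cot tau in
  0 < tau -> tau <= pi / 2 -> b != 0 -> a ^+ 2 + b ^+ 2 = 1 ->
  is_derive (0 : R) 1 theta d -> d = b * sin tau * k ->
  (\forall h \near (0 : R), cis (2 * theta h) * \det (M h + (a +i* b)%C%:M)
     = C * \det (M h + (a -i* b)%C%:M)) ->
  graph_metric tau (A 0) \in unitmx /\
  \tr (invmx (graph_metric tau (A 0)) *m A') = k.
Proof.
move=> a t0 t2 b0 ab dtheta dE near_eq.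
have sn0 : sin tau != 0 by rewrite gt_eqF // sin_gt0.
(* A real eigenvalue cannot cancel a nonzero imaginary part. *)
have shift_neq0 (x y : R) : y != 0 -> forall i, RC (l 0 0 i) + (x +i* y)%C != 0.
  by move=> y0 i; rewrite eq_complex /= add0r (negPf y0) andbF.
have Up := shift_unit (shift_neq0 a (- b) (_ : - b != 0)).
have {}Up : M 0 + (a -i* b)%C%:M \in unitmx by apply: Up; rewrite oppr_eq0.
have Uq : M 0 + (a +i* b)%C%:M \in unitmx := shift_unit (shift_neq0 a b b0).
apply: (graph_metric_trace (p := (a -i* b)%C) (q := (a +i* b)%C)) => //.
- rewrite (cos_cot t0 t2) -/a.
  by apply/eqP; rewrite eq_complex /=; apply/andP; split; apply/eqP; ring.
- apply/eqP; rewrite eq_complex /=; apply/andP; split; apply/eqP; last ring.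
  by rewrite -ab; ring.
have d2 : is_derive (0 : R) 1 (fun h => 2 * theta h) (2 * d) by exact: is_deriveZ.
have H := logderiv_ratio mderiv_complexified (cderiv_cis d2) near_eq
  (cis_neq0 _) Up Uq.
(* This is [q - p], the factor produced by [logderiv_ratio]. *)
have i0 : ((2 * b) *i)%C != 0 :> R[i].
  by rewrite eq_complex /= eqxx /= mulf_neq0.
apply: (mulfI i0); transitivity (((2 * d) *i)%C : R[i]).
  by apply/eqP; rewrite eq_complex /= dE; apply/andP; split; apply/eqP; ring.
rewrite H; congr (_ * _).
by apply/eqP; rewrite eq_complex /=; apply/andP; split; apply/eqP; ring.
Qed.

(** Now [0 <= a < 1] and [b ^+ 2 = 1 - a ^+ 2]. Each eigenvalue contributes the constant (1 + i) /
    (1 - i) = i, whence [C] is the [n]-th power of i. *)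
Lemma trace_identity_arctan (tau : R) : pi / 4 < tau -> tau < pi / 2 ->
  let a := cot tau in let b := bcoef tau in
  (\forall h \near (0 : R), forall i, l h 0 i + a + b != 0) ->
  (\forall h \near (0 : R), Num.sqrt (a ^+ 2 + 1) / b
      * \sum_i atan ((l h 0 i + a - b) / (l h 0 i + a + b)) = S h) ->
  graph_metric tau (A 0) \in unitmx /\
  \tr (invmx (graph_metric tau (A 0)) *m A') = k.
Proof.
move=> t1 t3 a b def eqS.
have t0 : 0 < tau by have := pi_gt0 R; lra.
have t2 := ltW t3.
have s0 := sin_gt0 t0 t2; have sn0 : sin tau != 0 by rewrite gt_eqF.
have a1 : a < 1 := cot_lt1 t0 t2 t1.
have a0 : 0 <= a := cot_ge0 t0 t2.
have a2 : a ^+ 2 - 1 < 0 by rewrite subr_lt0 expr_lt1.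
have bn0 : b != 0 by rewrite gt_eqF // sqrtr_gt0 normr_gt0 lt_eqF.
have bb : b ^+ 2 = 1 - a ^+ 2.
  by rewrite sqr_sqrtr ?normr_ge0 // ltr0_norm // opprB.
rewrite (sqrt_cot t0 t2) in eqS.
apply: (trace_identity_cis (b := b) (theta := fun h => b * sin tau * S h)
  (C := 'i%C ^+ n) t0 t2 bn0 _ (is_deriveZ _ hS)) => //.
  by rewrite -/a bb; ring.
rewrite -/a; near=> h; rewrite !(det_shift (l := l h)); do ?by near: h.
have -> : b * sin tau * S h = \sum_i atan ((l h 0 i + a - b) / (l h 0 i + a + b)).
  have <- : (sin tau)^-1 / b * \sum_i atan ((l h 0 i + a - b) / (l h 0 i + a + b)) = S h
    by near: h.
  by field; rewrite bn0 sn0.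
have hdef : forall i, l h 0 i + a + b != 0 by near: h.
rewrite mulr_sumr cis_sum exprn_prod_ord -!big_split.
apply: eq_bigr => i _ /=; have := cis_2atan (l h 0 i + a - b) (hdef i).
(* (l + a + b) + i (l + a - b) = (1 + i) (l + a - i b). *)
set z := cis _ => H; apply: (mulfI (_ : (1 -i* 1)%C != 0)).
  by rewrite eq_complex /= oner_eq0.
transitivity (z * ((l h 0 i + a + b) -i* (l h 0 i + a - b))%C).
  rewrite mulrCA; congr (_ * _).
  by apply/eqP; rewrite eq_complex /=; apply/andP; split; apply/eqP; ring.
rewrite -H.
by apply/eqP; rewrite eq_complex /=; apply/andP; split; apply/eqP; ring.
Unshelve. all: by end_near. Qed.

(** The roots are -i and i. Since 1 + i l = i (l - i) and 1 - i l = -i (l + i), each eigenvalue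
    contributes -1 to [C]. *)
Lemma trace_identity_pihalf :
  (\forall h \near (0 : R), \sum_i atan (l h 0 i) = S h) ->
  graph_metric (pi / 2) (A 0) \in unitmx /\
  \tr (invmx (graph_metric (pi / 2) (A 0)) *m A') = k.
Proof.
move=> eqS.
have t0 : 0 < pi / 2 :> R by have := pi_gt0 R; lra.
have c0 : cot (pi / 2) = 0 :> R by rewrite /cot cos_pihalf mul0r.
apply: (trace_identity_cis (b := 1) (C := (-1) ^+ n) t0 (lexx _) _ _ hS) => //.
  by rewrite c0; ring.
  by rewrite sin_pihalf !mul1r.
rewrite c0; near=> h; rewrite !(det_shift (l := l h)); do ?by near: h.
have <- : \sum_i atan (l h 0 i) = S h by near: h.
rewrite mulr_sumr cis_sum exprn_prod_ord -!big_split.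
apply: eq_bigr => i _ /=; have := cis_2atan (l h 0 i) (oner_neq0 R).
rewrite divr1; set z := cis _ => H; apply: (mulfI (_ : (0 -i* 1)%C != 0)).
  by rewrite eq_complex /= oppr_eq0 oner_eq0 andbF.
transitivity (z * (1 -i* l h 0 i)%C).
  rewrite mulrCA; congr (_ * _).
  by apply/eqP; rewrite eq_complex /=; apply/andP; split; apply/eqP; ring.
rewrite -H.
by apply/eqP; rewrite eq_complex /=; apply/andP; split; apply/eqP; ring.
Unshelve. all: by end_near. Qed.

Lemma Ftau_trace_identity (tau : R) : 0 <= tau -> tau <= pi / 2 ->
  (\forall h \near (0 : R), Ftau_defined tau (l h)) ->
  (\forall h \near (0 : R), Ftau tau (l h) = S h) ->
  graph_metric tau (A 0) \in unitmx /\
  \tr (invmx (graph_metric tau (A 0)) *m A') = k.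
Proof.
rewrite le_eqVlt /Ftau_defined /Ftau => /predU1P[<- _|t0 t2].
  by rewrite eqxx; exact: trace_identity_log.
rewrite (gt_eqF t0); case: ltgtP => [t1|t1|->].
- exact: trace_identity_ratio.
- case: ltP => [t3|t3] def.
    exact: trace_identity_arctan.
  have -> : tau = pi / 2 by apply/eqP; rewrite eq_le t2.
  exact: trace_identity_pihalf.
- exact: trace_identity_resolvent.
Qed.

End TraceIdentity.

(** * Symmetry of mixed second derivatives *)

Section Schwarz.
Context {R : realType} {V : normedModType R}.
Implicit Types (f : V -> R) (x u v : V).

Lemma is_derive_line f x v (s : R) : derivable f (x + s *: v) v ->
  is_derive s 1 (fun t : R => f (x + t *: v)) ('D_v f (x + s *: v)).
Proof.
have E : (fun h : R => h^-1 *: (f (x + (h *: (1 : R) + s) *: v) - f (x + s *: v)))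
       = (fun h : R => h^-1 *: (f (h *: v + (x + s *: v)) - f (x + s *: v))).
  by apply/funext => h; rewrite [h *: 1]mulr1 scalerDl addrCA.
move=> df; split; first by rewrite /derivable E.
by rewrite /derive E.
Qed.

Lemma MVT_line f x v (h : R) : 0 < h ->
  (forall s, 0 <= s <= h -> derivable f (x + s *: v) v) ->
  exists2 s, 0 < s < h & f (x + h *: v) - f x = 'D_v f (x + s *: v) * h.
Proof.
move=> h0 df.
have [| |s] := @MVT R (fun t => f (x + t *: v)) (fun t => 'D_v f (x + t *: v)) 0 h h0.
- by move=> s /itvP sh; apply/is_derive_line/df; rewrite !(ltW, sh).
- apply: derivable_within_continuous => s; rewrite in_itv /= => sh.
  by have [] := is_derive_line (df s sh).
by rewrite in_itv /= scale0r addr0 subr0 => sh ->; exists s.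
Qed.

Definition second_difference f x u v (h : R) :=
  (f (x + h *: u + h *: v) - f (x + h *: u)) - (f (x + h *: v) - f x).

Lemma second_differenceC f x u v h :
  second_difference f x u v h = second_difference f x v u h.
Proof. by rewrite /second_difference [x + _ + _]addrAC; ring. Qed.

(** Two applications of the mean value theorem, first along [u] and then along [v], turn the second
    difference into [h ^+ 2] times the mixed derivative at a nearby point; continuity does the
    rest. *)
Lemma second_difference_approx f (U : set V) x u v : open U -> U x ->
  (forall y, U y -> derivable f y u) ->
  (forall y, U y -> derivable ('D_u f) y v) ->
  {for x, continuous ('D_v ('D_u f))} ->
  forall e, 0 < e -> exists2 d, 0 < d & forall h, 0 < h < d ->
    exists2 w, `|w - 'D_v ('D_u f) x| < e & second_difference f x u v h = w * h ^+ 2.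
Proof.
move=> oU Ux dfu dfuv cont e e0.
have : \forall y \near x, U y /\ `|'D_v ('D_u f) y - 'D_v ('D_u f) x| < e.
  near=> y; split; first by near: y; exact: open_nbhs_nbhs.
  rewrite distrC; near: y.
  by move/cvgrPdist_lt : cont => /(_ e e0).
move=> /nbhs_ballP[r /= r0 rP].
have N0 : 0 < `|u| + `|v| + 1 by rewrite ltr_wpDl ?addr_ge0.
(* The summand 1 keeps the denominator positive even when [u] and [v] vanish. *)
exists (r / (`|u| + `|v| + 1)); first by rewrite divr_gt0.
move=> h /andP[h0]; rewrite ltr_pdivlMr // => hr.
have inU s t : 0 <= s <= h -> 0 <= t <= h -> ball x r (x + s *: u + t *: v).
  move=> /andP[s0 sh] /andP[t0 th]; rewrite -ball_normE /ball_ /=.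
  rewrite -addrA opprD addNKr normrN.
  apply: le_lt_trans hr; apply: le_trans (ler_normD _ _) _.
  rewrite !normrZ !ger0_norm // !mulrDr mulr1.
  by rewrite ler_wpDr ?(ltW h0) // lerD // ler_wpM2r.
have hh : 0 <= h <= h by rewrite lexx ltW.
have h00 : (0 : R) <= (0 : R) <= h by apply/andP; split => //; exact: ltW.
(* The second difference is the increment of [g] from [x] to [x + h *: u]. *)
pose g y := f (y + h *: v) - f y.
have shift_derivable y : U (y + h *: v) ->
    is_derive y u (fun y => f (y + h *: v)) ('D_u f (y + h *: v)).
  move=> Uy.
  have E : (fun k : R => k^-1 *: (f (k *: u + y + h *: v) - f (y + h *: v)))
       = (fun k : R => k^-1 *: (f (k *: u + (y + h *: v)) - f (y + h *: v))).
    by apply/funext => k; rewrite addrA.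
  have := dfu _ Uy; rewrite /derivable -E => df; split => //.
  by rewrite /derive E.
have dg s : 0 <= s <= h -> is_derive (x + s *: u) u g
    ('D_u f (x + s *: u + h *: v) - 'D_u f (x + s *: u)).
  move=> sh; apply: is_deriveB.
    by apply: shift_derivable; apply: (rP _ (inU _ _ sh hh)).1.
  apply: derivableP; apply: dfu.
  by have := (rP _ (inU _ _ sh h00)).1; rewrite scale0r addr0.
have [s sh|s /andP[s0 sh] gE] := MVT_line (f := g) (x := x) (v := u) h0.
  by have [] := dg s sh.
have sh' : 0 <= s <= h by rewrite !ltW.
have [t th|t /andP[t0 th] DE] :=
    MVT_line (f := 'D_u f) (x := x + s *: u) (v := v) h0.
  by apply/dfuv; apply: (rP _ (inU _ _ sh' th)).1.
exists ('D_v ('D_u f) (x + s *: u + t *: v)).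
  by apply: (rP _ (inU _ _ sh' _)).2; rewrite !ltW.
rewrite expr2 mulrA -DE.
have [_ <-] := dg s sh'.
exact: gE.
Unshelve. all: by end_near. Qed.

(** The second difference is symmetric in [u] and [v], so for small [h] both mixed derivatives lie
    within [e / 2] of the same number. *)
Lemma schwarz_symmetry f (U : set V) x u v : open U -> U x ->
  (forall y, U y -> derivable f y u) -> (forall y, U y -> derivable f y v) ->
  (forall y, U y -> derivable ('D_u f) y v) ->
  (forall y, U y -> derivable ('D_v f) y u) ->
  {for x, continuous ('D_v ('D_u f))} -> {for x, continuous ('D_u ('D_v f))} ->
  'D_v ('D_u f) x = 'D_u ('D_v f) x.
Proof.
move=> oU Ux fu fv fuv fvu cuv cvu.
apply/eqP; rewrite -subr_eq0 -normr_le0; apply/ler_addgt0Pr => e e0; rewrite add0r.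
have e2 : 0 < e / 2 by rewrite divr_gt0.
have [d1 d10 H1] := second_difference_approx oU Ux fu fuv cuv e2.
have [d2 d20 H2] := second_difference_approx oU Ux fv fvu cvu e2.
pose h := Num.min d1 d2 / 2.
have m0 : 0 < Num.min d1 d2 by rewrite lt_min d10.
have h0 : 0 < h by rewrite divr_gt0.
have hm : h < Num.min d1 d2 by rewrite /h; lra.
move: hm; rewrite lt_min => /andP[h1 h2].
have [|w1 w1e] := H1 h; first by rewrite h0.
have [|w2 w2e] := H2 h; first by rewrite h0.
rewrite second_differenceC => -> /(mulIf _) w12.
have {w12} w12 : w2 = w1 by apply: w12; rewrite expf_neq0 // gt_eqF.
rewrite w12 in w2e; move: w1e w2e.
move: ('D_v ('D_u f) x) ('D_u ('D_v f) x) => a b w1a w1b.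
apply: le_trans (ler_distD w1 _ _) _.
by rewrite (splitr e) lerD // ltW // distrC.
Qed.

End Schwarz.

(** * Partial derivatives of smooth functions *)

Section SmoothFunctions.
Context {R : realType} {n : nat}.
Implicit Types (U : set 'rV[R]_n) (f : 'rV[R]_n -> R).

Lemma smooth_on_partial U f (i : 'I_n) : smooth_on U f -> smooth_on U (partial i f).
Proof.
by move=> sf s x Ux; have := sf (rcons s i) x Ux; rewrite /iter_partial foldr_rcons.
Qed.

Lemma smooth_on_derivable U f x i : smooth_on U f -> U x ->
  derivable f x (delta_mx 0 i).
Proof. by move=> sf Ux; have [_] := sf [::] x Ux. Qed.

Lemma partialC U f x i j : open U -> smooth_on U f -> U x ->
  partial i (partial j f) x = partial j (partial i f) x.
Proof.
move=> oU sf Ux.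
have dfi k y : U y -> derivable f y (delta_mx 0 k) by exact: smooth_on_derivable.
have dfij k m y : U y -> derivable (partial k f) y (delta_mx 0 m).
  exact/smooth_on_derivable/smooth_on_partial.
apply: (schwarz_symmetry oU Ux (dfi j) (dfi i) (dfij j i) (dfij i j)).
  by have [] := sf [:: i; j] x Ux.
by have [] := sf [:: j; i] x Ux.
Qed.

(** Openness of [U] makes the two inner derivatives agree on a whole neighbourhood of [x], so they
    may be exchanged under [partial m]. *)
Lemma near_partialC U f x i j m : open U -> smooth_on U f -> U x ->
  partial m (partial i (partial j f)) x = partial m (partial j (partial i f)) x.
Proof.
move=> oU sf Ux; apply: near_eq_derive; near=> y; apply: (partialC (U := U)) => //.
by near: y; exact: open_nbhs_nbhs.
Unshelve. all: by end_near. Qed.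

(** The reversal is a product of three adjacent transpositions. *)
Lemma partial3_rev U f x i j m : open U -> smooth_on U f -> U x ->
  partial i (partial j (partial m f)) x = partial m (partial j (partial i f)) x.
Proof.
move=> oU sf Ux; apply: etrans (near_partialC j m i oU sf Ux) _.
apply: etrans (partialC i m oU (smooth_on_partial j sf) Ux) _.
exact: near_partialC i j m oU sf Ux.
Qed.

Lemma hessian_sym U f x : open U -> smooth_on U f -> U x ->
  (hessian f x)^T = hessian f x.
Proof.
by move=> oU sf Ux; apply/matrixP => i j; rewrite !mxE; exact: partialC oU sf Ux.
Qed.

End SmoothFunctions.

(** * Induced metric and derivatives of the tangent frame *)

Section GraphGeometry.
Context {R : realType} {n : nat}.
Implicit Types (U : set 'rV[R]_n) (u : 'rV[R]_n -> R).

Lemma induced_metricE tau U u x : open U -> smooth_on U u -> U x ->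
  induced_metric tau u x = graph_metric tau (hessian u x).
Proof.
move=> oU su Ux; rewrite /induced_metric /tangent /gmetric /delta0 /g0.
rewrite mulmxDr -!scalemxAr mulmx1 mul_row_block mulmx0 mul1mx mulmx1 add0r.
rewrite mulmx0 addr0 tr_row_mx trmx1 (hessian_sym oU su Ux).
rewrite mulmxDl -!scalemxAl !mul_row_col !mulmx1 !mul1mx /graph_metric.
by rewrite -[hessian u x + hessian u x]mulr2n -scaler_nat scalerA [_ * 2]mulrC.
Qed.

Lemma flat_derivE U u x i j : open U -> smooth_on U u -> U x ->
  flat_deriv u x i j =
  row_mx 0 (\row_m partial i (partial j (partial m u)) x).
Proof.
move=> oU su Ux.
(* Entrywise, [E_j] is constant in the first block and a second partial derivative of [u] in the
   other. *)
have entryE (a : 'I_1) (m : 'I_n + 'I_n) :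
    (fun y => row j (tangent u y) a (unsplit m)) =
    match m with
    | inl m => fun=> (1%:M : 'M[R]_n) j m
    | inr m => partial j (partial m u)
    end.
  by apply/funext => y; case: m => m; rewrite mxE /= ?row_mxEl ?row_mxEr // mxE.
rewrite /flat_deriv derive_mx.
  apply/matrixP => a m; rewrite mxE -(splitK m) entryE ord1.
  case: (fintype.split m) => b /=; first by rewrite row_mxEl [RHS]mxE; exact: derive_cst.
  by rewrite row_mxEr mxE.
apply/derivable_mxP => a m; rewrite -(splitK m) entryE.
case: (fintype.split m) => b; first exact: derivable_cst.
exact: smooth_on_derivable _ (smooth_on_partial _ (smooth_on_partial _ su)) Ux.
Qed.

Lemma normal_part_sum tau u x (I : finType) (c : I -> R)
    (V : I -> 'rV[R]_(n + n)) :
  \sum_i c i *: normal_part tau u x (V i) =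
  normal_part tau u x (\sum_i c i *: V i).
Proof.
by rewrite /normal_part mulmx_suml; apply: eq_bigr => i _; rewrite scalemxAl.
Qed.

End GraphGeometry.

(** * The mean curvature vector of the gradient graph *)

Unset Implicit Arguments.
Set Strict Implicit.

Theorem corollary1p2 (R : realType) (n : nat) (tau : R)
    (Om Omt : set 'rV[R]_n) (kappa : 'rV[R]_n) (c : R) (u : 'rV[R]_n -> R)
    (htau0 : 0 <= tau) (htau1 : tau <= pi / 2)
    (hOm : uniformly_convex_bounded_smooth_domain Om)
    (hOmt : uniformly_convex_bounded_smooth_domain Omt)
    (hu : smooth_on Om u)
    (hdef : forall x, Om x -> Ftau_defined tau (eigenvalues (hessian u x)))
    (heq : forall x, Om x ->
       Ftau tau (eigenvalues (hessian u x)) = dot kappa x + c)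
    (hDu : grad u @` Om = Omt) :
  forall x, Om x ->
    induced_metric tau u x \in unitmx /\
    mean_curvature_vector tau u x = normal_part tau u x (row_mx 0 kappa).
Proof.
move=> x Omx; have [[_ oOm _] _ _ _] := hOm.
(* The trace identity is applied to the Hessian along the line through [x] in the direction of the
   [m]-th coordinate. *)
have key m : induced_metric tau u x \in unitmx /\
    \tr (invmx (induced_metric tau u x) *m
      \matrix_(i, j) partial m (partial i (partial j u)) x) = kappa 0 m.
  pose e : 'rV[R]_n := delta_mx 0 m.
  pose A (h : R) := hessian u (x + h *: e).
  have x0 : x + (0 : R) *: e = x by rewrite scale0r addr0.
  have near_Om : \forall h \near (0 : R), Om (x + h *: e).
    have : (fun h : R => x + h *: e) @ (0 : R) --> x + (0 : R) *: e.
      by apply: cvgD; [exact: cvg_cst|apply: cvgZr_tmp; exact: cvg_id].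
    by apply; rewrite x0; exact: open_nbhs_nbhs.
  rewrite (induced_metricE tau oOm hu Omx) -[in hessian u x]x0.
  apply: (@Ftau_trace_identity R n A _ (fun h => eigenvalues (A h))
    (fun h => dot kappa (x + h *: e) + c)) => //.
  - move=> i j; rewrite [X in is_derive _ _ _ X]mxE /A.
    under eq_fun do rewrite mxE.
    rewrite -[in X in is_derive _ _ _ X]x0; apply: is_derive_line; rewrite x0.
    exact: smooth_on_derivable _ (smooth_on_partial _ (smooth_on_partial _ hu)) Omx.
  - near=> h; apply: eigenvaluesP; apply: hessian_sym oOm hu _.
    by near: h.
  (* Along this line the right-hand side is affine with slope [kappa 0 m]. *)
  - rewrite (_ : (fun h => _) = cst (dot kappa x + c) + (kappa 0 m \*: id)).
      by apply: is_derive_eq; rewrite add0r /GRing.scale /= mulr1.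
    apply/funext => h /=; rewrite /dot addrAC; congr (_ + _).
    under eq_bigr do rewrite !mxE mulrDr.
    rewrite big_split /=; congr (_ + _).
    rewrite (bigD1 m) //= !eqxx mulr1 big1 ?addr0 // => i /negPf im.
    by rewrite im !mulr0.
  - by near=> h; apply: hdef; near: h.
  - by near=> h; apply: heq; near: h.
split.
  (* [key] needs an index; for [n = 0] the metric is the empty matrix, which is the identity. *)
  case: (pickP 'I_n) => [m _|no_index]; first by have [] := key m.
  rewrite (_ : induced_metric _ _ _ = 1%:M) ?unitmx1 //.
  by apply/matrixP => i; have := no_index i.
rewrite /mean_curvature_vector.
(* The factor 1 gives the outer sum the shape required by [normal_part_sum], so that a single
   projection remains. *)
under eq_bigr do rewrite normal_part_sum -[normal_part _ _ _ _]scale1r.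
rewrite normal_part_sum; congr (normal_part _ _ _ _).
under eq_bigr do rewrite scale1r.
(* Reversing the derivatives puts [m] outermost and [i], [j] in the transposed order in which the
   trace of the matrix product in [key] pairs them. *)
have flatE i j : flat_deriv u x i j =
    row_mx 0 (\row_m partial m (partial j (partial i u)) x).
  have rowE : \row_m partial i (partial j (partial m u)) x =
      \row_m partial m (partial j (partial i u)) x.
    apply/rowP => m; rewrite [LHS]mxE [RHS]mxE.
    exact: (partial3_rev i j m oOm hu Omx).
  exact: etrans (flat_derivE i j oOm hu Omx) (congr1 (row_mx 0) rowE).
apply/rowP => b; rewrite summxE; under eq_bigr do rewrite summxE.
rewrite -(splitK b); case: (fintype.split b) => m /=.
  rewrite row_mxEl mxE big1 // => i _; rewrite big1 // => j _.
  by rewrite mxE flatE row_mxEl mxE mulr0.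
rewrite row_mxEr -(key m).2; apply: eq_bigr => i _; rewrite [RHS]mxE.
by apply: eq_bigr => j _; rewrite mxE flatE row_mxEr !mxE.
Unshelve. all: by end_near. Qed.
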